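(* Let $X$ be a real Banach space, $g:[a,b]\to X$, $x\in[a,b]$, and suppose that $g$ is metrically differentiable at $x$ with $md(g,x)>0$, and that $md(g,\cdot)$ is continuous at $x$. Then $x$ is a bilaterally metrically regular point of the function $g$.
   Context: For $g:[a,b]\to X$, the unilateral metric derivatives are $md_{\pm}(g,x)=\lim_{t\to0+}\frac{\|g(x\pm t)-g(x)\|}{t}$. If both exist and are equal (and finite), their common value is the metric derivative $md(g,x)$; at an endpoint of $[a,b]$ only the one-sided limit taken inside $[a,b]$ is used. ''$md(g,\cdot)$ is continuous at $x$'' means that $md(g,s)$ exists for all $s\in[a,b]$ in some neighbourhood of $x$ and $md(g,s)\to md(g,x)$ as $s\to x$, $s\in[a,b]$. The mapping $g$ is metrically differentiable at $x$ if $md(g,x)$ exists and $\|g(y)-g(z)\|-md(g,x)|y-z|=o(|y-x|+|z-x|)$ as $(y,z)\to(x,x)$ with $y,z\in[a,b]$. $\bigvee_y^z g$ denotes the total variation of $g$ on $[y,z]$. A point $x\in[a,b]$ is a bilaterally metrically regular point of $g$ if $\frac{\|g(y)-g(z)\|}{\bigvee_y^z g}\to1$ as $(y,z)\to(x,x)$ with $a\le y\le x\le z\le b$, $(y,z)\ne(x,x)$ (in particular the denominator is nonzero for all such $(y,z)$ close to $(x,x)$). *)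

(* Defs.v *)
From HB Require Import structures.
From mathcomp Require Import all_boot all_order all_algebra.
From mathcomp Require Import all_classical all_reals all_analysis.
Set Implicit Arguments.
Unset Strict Implicit.
Unset Printing Implicit Defensive.
Import Order.TTheory GRing.Theory Num.Theory.
Import numFieldNormedType.Exports.
Local Open Scope classical_set_scope.
Local Open Scope ring_scope.

(* A map [a, b] -> X is represented by a function g : R -> X; every notion
   below depends only on the values of g on [a, b]. *)

Section MetricRegularity.
Context {R : realType} {X : normedModType R}.
Implicit Types (a b x : R) (g : R -> X).

Definition md_quot_right g x : R -> R := fun t => `|g (x + t) - g x| / t.
Definition md_quot_left g x : R -> R := fun t => `|g (x - t) - g x| / t.

Definition md_right g x : R := lim (md_quot_right g x t @[t --> 0^'+]).
Definition md_left g x : R := lim (md_quot_left g x t @[t --> 0^'+]).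

(* Each unilateral derivative is required only at the points of [a, b] where
   it can be taken inside [a, b]; convergence is in R, hence to a finite
   limit. *)
Definition md_exists a b g x : Prop :=
  [/\ x < b -> cvg (md_quot_right g x t @[t --> 0^'+]),
      a < x -> cvg (md_quot_left g x t @[t --> 0^'+]) &
      a < x < b -> md_right g x = md_left g x].

(* The value of the metric derivative, meaningful under md_exists a b g x. *)
Definition md b g x : R := if x < b then md_right g x else md_left g x.

Definition md_continuous_at a b g x : Prop :=
  (\forall s \near within `[a, b] (nbhs x), md_exists a b g s) /\
  md b g s @[s --> within `[a, b] (nbhs x)] --> md b g x.

Definition metrically_differentiable a b g x : Prop :=
  md_exists a b g x /\
  let F := within (`[a, b] `*` `[a, b]) (nbhs (x, x)) in
  (fun p : R * R => `|g p.1 - g p.2| - md b g x * `|p.1 - p.2|)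
    =o_F (fun p : R * R => `|p.1 - x| + `|p.2 - x|).

(* numfun.variation and realfun.total_variation are restricted to real-valued
   functions; these are the same definitions for values in X. *)
Definition vvariation a b g (s : seq R) : R :=
  let G := g \o nth b (a :: s) in
  \sum_(0 <= n < size s) `|G n.+1 - G n|.

Definition vtotal_variation a b g : \bar R :=
  ereal_sup [set (vvariation a b g s)%:E | s in itv_partition a b].

Definition straddling_pairs a b x : set (R * R) :=
  [set p | [/\ a <= p.1, p.1 <= x, x <= p.2, p.2 <= b & p != (x, x)]].

(* The variation may be infinite.  Such pairs, on which the quotient is read
   as 0, cannot occur close to (x, x); this is made explicit so that the use
   of fine and of division by 0 is harmless. *)
Definition bilaterally_metrically_regular a b g x : Prop :=
  (\forall p \near within (straddling_pairs a b x) (nbhs (x, x)),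
     (0 < vtotal_variation p.1 p.2 g < +oo)%E) /\
  `|g p.1 - g p.2| / fine (vtotal_variation p.1 p.2 g)
    @[p --> within (straddling_pairs a b x) (nbhs (x, x))] --> (1 : R).

End MetricRegularity.

(* Main.v *)
(** Write m = md(g,x).  Near x every md(g,s) is below m + e, and a unilateral
    metric derivative bound propagates by a supremum argument to the Lipschitz
    bound |g v - g u| <= (m + e) (v - u), so the variation on [y,z] is at most
    (m + e) (z - y).  Metric differentiability at x gives
    |g y - g z| >= (m - e) (z - y) when y <= x <= z, because then
    |y - x| + |z - x| = z - y.  Hence the quotient lies between
    (m - e) / (m + e) and 1. *)
Require Import Defs.
From HB Require Import structures.
From mathcomp Require Import all_boot all_order all_algebra.
From mathcomp Require Import all_classical all_reals all_analysis.
From mathcomp Require Import lra.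
Set Implicit Arguments.
Unset Strict Implicit.
Unset Printing Implicit Defensive.
Import Order.TTheory GRing.Theory Num.Theory.
Import numFieldNormedType.Exports.
Local Open Scope classical_set_scope.
Local Open Scope ring_scope.

Section LipschitzBound.
Context {R : realType} {X : normedModType R}.
Implicit Types (a b x u v L : R) (g : R -> X).

Lemma lipschitz_of_unilateral_bounds g u v L : u <= v ->
  (forall s, u <= s < v -> \forall t \near 0^'+, `|g (s + t) - g s| <= L * t) ->
  (forall s, u < s <= v -> \forall t \near 0^'+, `|g (s - t) - g s| <= L * t) ->
  `|g v - g u| <= L * (v - u).
Proof.
move=> uv gr gl.
have chain r s t : `|g s - g r| <= L * (s - r) -> `|g t - g s| <= L * (t - s) ->
    `|g t - g r| <= L * (t - r).
  move=> rs st; apply: le_trans (ler_distD (g s) _ _) _.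
  by apply: le_trans (lerD st rs) _; lra.
pose S := [set t | u <= t <= v /\ `|g t - g u| <= L * (t - u)].
have Su : S u by rewrite /S/= lexx uv !subrr normr0 mulr0.
have hsS : has_sup S.
  by split; [exists u | exists v => t [/andP[]]].
set c := sup S.
have uc : u <= c by apply: ub_le_sup => //; case: hsS.
have cv : c <= v by apply: ge_sup; [exists u | move=> t [/andP[]]].
have Sc : S c.
  have [ceu|cu] := eqVneq c u; first by rewrite ceu.
  have {}cu : u < c by rewrite lt_def cu.
  have [d /= d0 dP] := gl c (introT andP (conj cu cv)).
  have [t St ct] := sup_adherent d0 hsS.
  have tc : t <= c by apply: ub_le_sup => //; case: hsS.
  have [->//|tNc] := eqVneq c t.
  have {}tc : t < c by rewrite lt_def tNc.
  split; first by rewrite uc cv.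
  apply: (chain _ t); first by case: St.
  have := dP (c - t); rewrite /= sub0r normrN gtr0_norm ?subr_gt0// subKr.
  rewrite distrC; apply => //.
  by rewrite ltrBlDr -ltrBlDl.
have [cev|cNv] := eqVneq c v; first by rewrite -cev; case: Sc.
have {}cv : c < v by rewrite lt_def eq_sym cNv.
have [d /= d0 dP] := gr c (introT andP (conj uc cv)).
pose h := Num.min (d / 2) (v - c).
have h0 : 0 < h by rewrite lt_min subr_gt0 cv divr_gt0.
have hd : h < d by rewrite gt_min ltr_pdivrMr// ltr_pMr// ltr1n.
have hv : c + h <= v by rewrite -lerBrDl ge_min lexx orbT.
have : S (c + h).
  split; first by rewrite hv andbT; lra.
  apply: (chain _ c); first by case: Sc.
  rewrite addrAC subrr add0r; apply: dP => //=.
  by rewrite sub0r normrN gtr0_norm.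
move=> /(ub_le_sup (proj2 hsS)); rewrite -/c; lra.
Qed.

Lemma md_lt_right_bound a b g s L : s < b -> md_exists a b g s -> md b g s < L ->
  \forall t \near 0^'+, `|g (s + t) - g s| <= L * t.
Proof.
move=> sb [/(_ sb) cr _ _]; rewrite /md sb /md_right => mL.
near=> t; have t0 : 0 < t by [].
have : md_quot_right g s t < L by near: t; exact: cvgr_lt mL.
by rewrite /md_quot_right ltr_pdivrMr// => /ltW.
Unshelve. all: by end_near.
Qed.

Lemma md_lt_left_bound a b g s L : a < s <= b -> md_exists a b g s -> md b g s < L ->
  \forall t \near 0^'+, `|g (s - t) - g s| <= L * t.
Proof.
move=> /andP[as_ sb] [_ /(_ as_) cl rl] mL.
have {}mL : md_left g s < L.
  move: mL; rewrite /md; case: (ltP s b) => // sltb.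
  by rewrite rl // as_ sltb.
near=> t; have t0 : 0 < t by [].
have : md_quot_left g s t < L by near: t; exact: cvgr_lt mL.
by rewrite /md_quot_left ltr_pdivrMr// => /ltW.
Unshelve. all: by end_near.
Qed.

Lemma md_lt_lipschitz a b g u v L : a <= u -> u <= v -> v <= b ->
  (forall s, u <= s <= v -> md_exists a b g s /\ md b g s < L) ->
  `|g v - g u| <= L * (v - u).
Proof.
move=> au uv vb mdL; apply: lipschitz_of_unilateral_bounds => // s /andP[us sv].
  have [|? ?] := mdL s; first by rewrite us ltW.
  by apply: (@md_lt_right_bound a b) => //; apply: lt_le_trans vb.
have [|? ?] := mdL s; first by rewrite (ltW us).
apply: (@md_lt_left_bound a b) => //.
by rewrite (le_lt_trans au us) (le_trans sv vb).
Qed.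

Lemma vvariation_le_lipschitz g u v L (s : seq R) : itv_partition u v s ->
  (forall y z, u <= y -> y <= z -> z <= v -> `|g z - g y| <= L * (z - y)) ->
  vvariation u v g s <= L * (v - u).
Proof.
elim: s u => [|c s IH] u usv gL.
  by rewrite /vvariation big_nil (itv_partition_nil usv) subrr mulr0.
have uc : u < c by case: usv => /= /andP[].
have csv := itv_partition_cons usv.
have cv := itv_partition_le csv.
rewrite /vvariation /= big_nat_recl//=.
have -> : L * (v - u) = L * (c - u) + L * (v - c) by lra.
apply: lerD; first by apply: gL => //; apply: ltW.
rewrite (_ : \sum_(_ <= _ < _) _ = vvariation c v g s).
  apply: IH => // y z cy; apply: gL; exact: le_trans (ltW uc) cy.
apply: eq_big_nat => i /andP[_ si] /=.
by case: i si => //= i si; congr (`| _ - _ |); congr g.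
Qed.

Lemma vtotal_variation_le_lipschitz g u v L :
  (forall y z, u <= y -> y <= z -> z <= v -> `|g z - g y| <= L * (z - y)) ->
  (vtotal_variation u v g <= (L * (v - u))%:E)%E.
Proof.
move=> gL; apply: ge_ereal_sup => _ [s us <-].
by rewrite lee_fin; apply: vvariation_le_lipschitz.
Qed.

Lemma norm_le_vtotal_variation g u v : u < v ->
  (`|g v - g u|%:E <= vtotal_variation u v g)%E.
Proof.
move=> uv; apply: ereal_sup_ubound; exists [:: v]; first exact: itv_partition1.
by rewrite /vvariation /= big_nat1.
Qed.

End LipschitzBound.

Theorem lemma5p1 (R : realType) (X : completeNormedModType R) (a b : R)
    (ab : a < b) (g : R -> X) (x : R) (xab : x \in `[a, b])
    (gdiff : metrically_differentiable a b g x) (md_gt0 : 0 < md b g x)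
    (md_cont : md_continuous_at a b g x) :
  bilaterally_metrically_regular a b g x.
Proof.
set m := md b g x in md_gt0 *.
have bounds e : 0 < e -> e < m ->
    \forall p \near within (straddling_pairs a b x) (nbhs (x, x)),
      [/\ p.1 < p.2, (m - e) * (p.2 - p.1) <= `|g p.1 - g p.2|,
       (`|g p.1 - g p.2|%:E <= vtotal_variation p.1 p.2 g)%E &
       (vtotal_variation p.1 p.2 g <= ((m + e) * (p.2 - p.1))%:E)%E].
  move=> e0 em.
  have [mdE mdC] := md_cont.
  have mdL : \forall s \near within `[a, b] (nbhs x),
      md_exists a b g s /\ md b g s < m + e.
    apply: filterI => //; apply: (cvgr_lt m mdC); lra.
  have [d /= d0 dP] := mdL.
  have near1 : \forall p \near nbhs (x, x), `|x - p.1| < d.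
    have pc : (fun p : R * R => p.1) @ nbhs (x, x) --> x by exact: cvg_fst.
    exact: ((cvgrPdist_lt _ _).1 pc).
  have near2 : \forall p \near nbhs (x, x), `|x - p.2| < d.
    have pc : (fun p : R * R => p.2) @ nbhs (x, x) --> x by exact: cvg_snd.
    exact: ((cvgrPdist_lt _ _).1 pc).
  have [_ /eqoP/(_ _ e0) gd] := gdiff.
  rewrite near_withinE.
  near=> p.
  move=> [ay yx xz zb pNx].
  have yz : p.1 < p.2.
    rewrite lt_neqAle (le_trans yx xz) andbT; apply: contra pNx => /eqP yz.
    by rewrite -pair_eqE /= -/(_ == _) eq_le yx yz xz /= eq_le -yz yx yz xz.
  split => //.
  - have : `| `|g p.1 - g p.2| - m * `|p.1 - p.2| | <= e * `| `|p.1 - x| + `|p.2 - x| |.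
      have : (`[a, b]%classic `*` `[a, b]%classic) p.
        by split; rewrite /= in_itv /=; apply/andP; split; lra.
      by near: p; move: gd; rewrite near_withinE.
    rewrite (distrC p.1 p.2) (distrC p.1 x) ler_norml => /andP[+ _].
    rewrite (gtr0_norm (_ : 0 < p.2 - p.1)) ?subr_gt0//.
    rewrite (ger0_norm (_ : 0 <= x - p.1)) ?subr_ge0//.
    rewrite (ger0_norm (_ : 0 <= p.2 - x)) ?subr_ge0//.
    rewrite (_ : x - p.1 + (p.2 - x) = p.2 - p.1); last by lra.
    rewrite gtr0_norm ?subr_gt0//.
    by move: (`|g p.1 - g p.2|) => ?; lra.
  - by rewrite distrC; exact: norm_le_vtotal_variation.
  apply: vtotal_variation_le_lipschitz => u v yu uv vz.
  apply: (@md_lt_lipschitz _ _ a b) => //; [exact: le_trans yu|exact: le_trans zb|].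
  move=> s /andP[us sv].
  have n1 : `|x - p.1| < d by near: p.
  have n2 : `|x - p.2| < d by near: p.
  apply: dP => /=; last by rewrite in_itv /=; apply/andP; split; lra.
  move: n1 n2; rewrite !ltr_norml => /andP[? ?] /andP[? ?]; apply/andP; split; lra.
split.
  have := bounds (m / 2) ltac:(lra) ltac:(lra).
  apply: filterS => p [yz lo loV upV]; apply/andP; split.
    apply: lt_le_trans loV; rewrite lte_fin; apply: lt_le_trans lo.
    by rewrite mulr_gt0 ?subr_gt0//; lra.
  by apply: le_lt_trans upV _; rewrite ltry.
apply/cvgrPdist_le => eps eps0.
pose e := Num.min (m / 2) (m * eps / 2).
have me : 0 < m * eps by rewrite mulr_gt0.
have e0 : 0 < e by rewrite lt_min; apply/andP; split; lra.
have em : e <= m / 2 by rewrite ge_min lexx.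
have ee : e <= m * eps / 2 by rewrite ge_min lexx orbT.
have := bounds e e0 ltac:(lra).
apply: filterS => p [yz lo loV upV].
case: (vtotal_variation p.1 p.2 g) loV upV => [V||]//=.
rewrite !lee_fin => loV upV.
have D0 : 0 < (m - e) * (p.2 - p.1) by rewrite mulr_gt0 ?subr_gt0//; lra.
have V0 : 0 < V by lra.
rewrite ger0_norm; last by rewrite subr_ge0 ler_pdivrMr// mul1r.
rewrite lerBlDl -lerBlDr ler_pdivlMr//.
have [eps1|eps1] := leP 1 eps.
  apply: le_trans (normr_ge0 _); nra.
apply: le_trans lo.
apply: (@le_trans _ _ ((1 - eps) * ((m + e) * (p.2 - p.1)))).
  by rewrite ler_wpM2l// subr_ge0 ltW.
rewrite mulrA ler_wpM2r ?subr_ge0 ?(ltW yz)//.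
nra.
Unshelve. all: by end_near.
Qed.
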